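(* For the matrix $$C_\eta^-:=\begin{bmatrix}1-\alpha(1-\gamma)+\eta&-\eta\\1&0\end{bmatrix}$$ one has $$\rho(C_\eta^-)<\rho(\mathcal A^{\rm QVI})=1-\alpha(1-\gamma)\iff 0<\eta<\rho(\mathcal A^{\rm QVI})^2,$$ where $\rho(C_\eta^-)$ is the ordinary spectral radius. Consequently, a necessary condition for the heavy-ball joint spectral radius to be smaller than that of standard QVI is the same range of $\eta$: if $\rho(\mathcal A^{\rm HB})<\rho(\mathcal A^{\rm QVI})$, then $0<\eta<\rho(\mathcal A^{\rm QVI})^2$.
   Context: Finite discounted MDP: finite state set $\mathcal S$, finite action set $\mathcal A$, transition probabilities $P(s'\mid s,a)$, discount factor $\gamma\in(0,1)$. Put $n=|\mathcal S||\mathcal A|$. $P\in\mathbb R^{n\times|\mathcal S|}$ is the matrix with $((s,a),s')$ entry $P(s'\mid s,a)$. $\Theta$ is the (finite) set of deterministic policies $\pi:\mathcal S\to\mathcal A$; $\Pi^\pi\in\mathbb R^{|\mathcal S|\times n}$ is the matrix with $(\Pi^\pi Q)(s)=Q(s,\pi(s))$ for $Q\in\mathbb R^n$. The step-size satisfies $0<\alpha\le1$ and the momentum parameter is $\eta\ge0$. Define $$A_\pi^{\rm QVI}=(1-\alpha)I+\alpha\gamma P\Pi^\pi,\qquad A_\pi^{\rm HB}=\begin{bmatrix}(1-\alpha+\eta)I+\alpha\gamma P\Pi^\pi&-\eta I\\ I&0\end{bmatrix},$$ $\mathcal A^{\rm QVI}=\{A_\pi^{\rm QVI}:\pi\in\Theta\}$,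 $\mathcal A^{\rm HB}=\{A_\pi^{\rm HB}:\pi\in\Theta\}$. For a bounded set $\mathcal H$ of square matrices, $\rho(\mathcal H)=\lim_{k\to\infty}\sup_{A_1,\dots,A_k\in\mathcal H}\|A_k\cdots A_1\|^{1/k}$ is the joint spectral radius. *)

(* Defs.v *)
From HB Require Import structures.
From mathcomp Require Import all_boot all_order all_algebra.
From mathcomp Require Import boolp classical_sets reals topology normedtype.
From mathcomp Require Import sequences exp.
From mathcomp Require Import complex.

Set Implicit Arguments.
Unset Strict Implicit.
Unset Printing Implicit Defensive.

Import Order.TTheory GRing.Theory Num.Theory.
Import numFieldNormedType.Exports.

Local Open Scope classical_set_scope.
Local Open Scope ring_scope.

(* The operator norm induced by the sup norm on vectors (maximal absolute row
   sum).  The joint spectral radius does not depend on the choice of a norm. *)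
Definition mx_infnorm (R : realType) (n : nat) (M : 'M[R]_n) : R :=
  \big[Num.max/0]_(i < n) \sum_(j < n) `|M i j|.

(* [rev_ord] makes the product read A_k *m ... *m A_1 (with A_1 = [F ord0]).
   The k-th root is the real power 1/k; the term k = 0 is irrelevant. *)
Definition jsr_seq (R : realType) (n : nat) (H : set 'M[R]_n) (k : nat) : R :=
  sup [set (mx_infnorm (\prod_(i < k) F (rev_ord i))) `^ (k%:R^-1)
      | F in [set F : 'I_k -> 'M[R]_n | forall i, H (F i)]].

Definition joint_spectral_radius (R : realType) (n : nat)
    (H : set 'M[R]_n) : R :=
  lim (jsr_seq H @ \oo).

(* [eigenvalue] is about row vectors, which does not change the spectrum; the
   eigenvalues are taken in the complex numbers R[i]. *)
Definition spectral_radius (R : realType) (n : nat) (M : 'M[R]_n) : R :=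
  sup [set ComplexField.Normc.normc z
      | z in [set z : R[i] | eigenvalue (map_mx (real_complex R) M) z]].

Definition is_transition (R : realType) (S A : finType)
    (P : S -> A -> S -> R) : Prop :=
  forall s a, (forall s', 0 <= P s a s') /\ \sum_(s' : S) P s a s' = 1.

(* Coordinates of R^n, n = |S||A|, are numbered through [enum_val] on S * A,
   those of R^|S| through [enum_val] on S; [P s a s'] stands for P(s' | s, a). *)
Definition trans_mx (R : realType) (S A : finType) (P : S -> A -> S -> R) :
    'M[R]_(#|{: S * A}|, #|S|) :=
  \matrix_(i, j) P (enum_val i).1 (enum_val i).2 (enum_val j).

Definition policy_mx (R : realType) (S A : finType) (pi : {ffun S -> A}) :
    'M[R]_(#|S|, #|{: S * A}|) :=
  \matrix_(i, j) (enum_val j == (enum_val i, pi (enum_val i)))%:R.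

Definition A_QVI (R : realType) (S A : finType) (P : S -> A -> S -> R)
    (gamma alpha : R) (pi : {ffun S -> A}) : 'M[R]_(#|{: S * A}|) :=
  (1 - alpha)%:M + (alpha * gamma) *: (trans_mx P *m policy_mx R pi).

Definition A_HB (R : realType) (S A : finType) (P : S -> A -> S -> R)
    (gamma alpha eta : R) (pi : {ffun S -> A}) :
    'M[R]_(#|{: S * A}| + #|{: S * A}|) :=
  block_mx
    ((1 - alpha + eta)%:M + (alpha * gamma) *: (trans_mx P *m policy_mx R pi))
    (- eta)%:M
    1%:M 0.

Definition QVI_family (R : realType) (S A : finType) (P : S -> A -> S -> R)
    (gamma alpha : R) : set 'M[R]_(#|{: S * A}|) :=
  range (A_QVI P gamma alpha).

Definition HB_family (R : realType) (S A : finType) (P : S -> A -> S -> R)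
    (gamma alpha eta : R) : set 'M[R]_(#|{: S * A}| + #|{: S * A}|) :=
  range (A_HB P gamma alpha eta).

Definition C_minus (R : realType) (gamma alpha eta : R) : 'M[R]_(1 + 1) :=
  block_mx (1 - alpha * (1 - gamma) + eta)%:M (- eta)%:M
           1%:M 0.

(* Main.v *)
Require Import Defs.
From mathcomp Require Import all_boot all_order all_algebra.
From mathcomp Require Import boolp classical_sets reals topology normedtype.
From mathcomp Require Import sequences exp complex.
From mathcomp Require Import ring lra zify.

(** Write r = 1 - alpha (1 - gamma), which lies in (0, 1).

    The matrix P Pi^pi is stochastic, so every QVI matrix is nonnegative with
    all row sums equal to r: its norm is at most r, and its k-th power maps the
    all-ones vector to r^k times itself.  These two facts squeeze the joint
    spectral radius of the QVI family to r ([joint_spectral_radius_QVI]).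

    The eigenvalues z, w of C_eta^- satisfy z + w = r + eta and z w = eta, so
    that |z| |w| = eta and (z - r) (w - r) = eta (1 - r).  If both moduli are
    below r, the product gives eta < r^2, and eta = 0 is excluded because r is
    then an eigenvalue.  Conversely let 0 < eta < r^2.  Conjugate roots have
    modulus sqrt eta < r.  Real roots are positive and lie on the same side of
    r, and this side is the left one since z w < r^2
    ([spectral_radius_C_minus_lt]).

    For the heavy-ball family, let J be the matrix whose two columns are the
    indicators of the two blocks of coordinates.  Stochasticity again gives
    A_pi^HB J = J C_eta^-, hence (A_pi^HB)^k J = J (C_eta^-)^k, and the norm of
    the k-th power of A_pi^HB dominates that of C_eta^-
    ([mx_infnorm_intertwine]).  Now eta^k = det (C_eta^-)^k is at most the
    square of the latter norm, so the joint spectral radius is at least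
    sqrt eta; and at eta = 0 the vector (r, 1) is an eigenvector for r, so it
    is at least r.  If the joint spectral radius is below r, then eta > 0 and
    sqrt eta < r.

    A bound on the terms of the sequence defining a joint spectral radius
    passes to its [lim] only if the sequence converges.  This is Fekete's lemma
    for the submultiplicative norm, [cvg_jsr_seq]. *)

Set Implicit Arguments.
Unset Strict Implicit.
Unset Printing Implicit Defensive.

Import Order.TTheory GRing.Theory Num.Theory.
Import numFieldNormedType.Exports.

Local Open Scope classical_set_scope.
Local Open Scope ring_scope.
Local Notation normc := ComplexField.Normc.normc.

(** * The row-sum norm *)

Section InfNorm.
Variable R : realType.

Lemma mx_infnorm_ge0 n (M : 'M[R]_n) : 0 <= mx_infnorm M.
Proof. exact: bigmax_ge_id. Qed.

Lemma ler_mx_infnorm n (M : 'M[R]_n) i : \sum_j `|M i j| <= mx_infnorm M.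
Proof. exact: (le_bigmax 0 (fun i => \sum_j `|M i j|)). Qed.

Lemma mx_infnorm_le n (M : 'M[R]_n) c :
  0 <= c -> (forall i, \sum_j `|M i j| <= c) -> mx_infnorm M <= c.
Proof. by move=> c0 Mc; apply: bigmax_le. Qed.

Lemma mx_infnormM n (M N : 'M[R]_n) :
  mx_infnorm (M *m N) <= mx_infnorm M * mx_infnorm N.
Proof.
apply: mx_infnorm_le => [|i]; first by rewrite mulr_ge0 ?mx_infnorm_ge0.
apply: (@le_trans _ _ (\sum_k `|M i k| * \sum_j `|N k j|)).
  under [leRHS]eq_bigr do rewrite mulr_sumr.
  rewrite exchange_big; apply: ler_sum => j _ /=; rewrite mxE.
  by apply: le_trans (ler_norm_sum _ _ _) _; apply: ler_sum => ? _; rewrite normrM.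
apply: (@le_trans _ _ (\sum_k `|M i k| * mx_infnorm N)).
  by apply: ler_sum => k _; rewrite ler_wpM2l // ler_mx_infnorm.
by rewrite -mulr_suml ler_wpM2r ?mx_infnorm_ge0 ?ler_mx_infnorm.
Qed.

Lemma mx_infnorm1_le n : mx_infnorm (1%:M : 'M[R]_n) <= 1.
Proof.
apply: mx_infnorm_le => // i; rewrite (bigD1 i) //= mxE eqxx normr1.
by rewrite big1 ?addr0 // => j ji; rewrite mxE eq_sym (negbTE ji) normr0.
Qed.

Lemma mx_infnorm_prod_le n (B : R) (s : seq 'M[R]_n) :
  0 <= B -> {in s, forall M, mx_infnorm M <= B} ->
  mx_infnorm (\prod_(M <- s) M) <= B ^+ size s.
Proof.
move=> B0; elim: s => [|M s IHs] sB; first by rewrite big_nil mx_infnorm1_le.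
rewrite big_cons exprS; apply: le_trans (mx_infnormM _ _) _.
rewrite ler_pM ?mx_infnorm_ge0 ?sB ?mem_head // IHs // => N Ns.
by rewrite sB // in_cons Ns orbT.
Qed.

Lemma mx_infnorm_scalar1 (c : R) k : c ^+ k <= mx_infnorm ((c%:M : 'M_1) ^+ k).
Proof.
rewrite -rmorphXn; apply: le_trans (ler_mx_infnorm _ ord0).
by rewrite big_ord1 mxE eqxx mulr1n ler_norm.
Qed.

Lemma mx_infnorm_const_rows n (M : 'M[R]_n) c : 0 <= c ->
  (forall i j, 0 <= M i j) -> M *m const_mx 1 = const_mx c :> 'cV_n ->
  mx_infnorm M <= c.
Proof.
move=> c0 M0 Mc; apply: mx_infnorm_le => // i.
have := congr1 (fun v : 'cV_n => v i 0) Mc; rewrite !mxE => <-.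
by apply: ler_sum => j _; rewrite mxE mulr1 ger0_norm.
Qed.

(** The hypotheses on J say that J has norm at most 1 and that, up to a
    selection of rows, J D contains D; so D is bounded by J D = M J, hence by
    M.  Typically J is the indicator matrix of a partition of the coordinates
    on whose classes M has constant block row sums D. *)
Lemma mx_infnorm_intertwine m p (M : 'M[R]_m) (D : 'M[R]_p) (J : 'M[R]_(m, p)) :
    M *m J = J *m D ->
    (forall j, \sum_l `|J j l| <= 1) ->
    (forall l, exists i, row i J = delta_mx 0 l) ->
  mx_infnorm D <= mx_infnorm M.
Proof.
move=> MJ J1 Jdelta; apply: mx_infnorm_le => [|l]; first exact: mx_infnorm_ge0.
have [i iJ] := Jdelta l; apply: le_trans (ler_mx_infnorm M i).
have DE k : D l k = \sum_j M i j * J j k.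
  transitivity (row i (M *m J) 0 k); last by rewrite !mxE.
  by rewrite MJ row_mul iJ -rowE mxE.
apply: (@le_trans _ _ (\sum_j `|M i j| * \sum_k `|J j k|)).
  under [leRHS]eq_bigr do rewrite mulr_sumr.
  rewrite exchange_big; apply: ler_sum => k _; rewrite DE.
  by apply: le_trans (ler_norm_sum _ _ _) _; apply: ler_sum => ? _; rewrite normrM.
by apply: ler_sum => j _; rewrite ler_piMr.
Qed.

Lemma intertwine_exp m p (M : 'M[R]_m) (D : 'M[R]_p) (J : 'M[R]_(m, p)) k :
  M *m J = J *m D -> M ^+ k *m J = J *m D ^+ k.
Proof.
move=> MJ; elim: k => [|k IHk]; first by rewrite !expr0 mul1mx mulmx1.
rewrite !exprS -[M * _]/(M *m _) -[D * _]/(D *m _).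
by rewrite -mulmxA IHk !mulmxA MJ.
Qed.

Lemma det_mx1D1 (M : 'M[R]_(1 + 1)) :
  \det M = ulsubmx M 0 0 * drsubmx M 0 0 - ursubmx M 0 0 * dlsubmx M 0 0.
Proof.
rewrite (expand_det_row _ (lshift 1 ord0)) big_split_ord !big_ord1.
rewrite /cofactor !det_mx11 !mxE expr0 expr1 mul1r mulN1r mulrN.
by congr (_ * M _ _ - _ * M _ _); exact: val_inj.
Qed.

(** Leibniz: |det M| is at most the permanent of |M|, which is at most the
    product of the two absolute row sums. *)
Lemma normr_det_le (M : 'M[R]_(1 + 1)) : `|\det M| <= mx_infnorm M ^+ 2.
Proof.
have row i : `|M i (lshift 1 ord0)| + `|M i (rshift 1 ord0)| <= mx_infnorm M.
  by have := ler_mx_infnorm M i; rewrite big_split_ord !big_ord1.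
have := row (rshift 1 ord0); have := row (lshift 1 ord0).
rewrite det_mx1D1 !mxE.
set a := M _ _; set b := M _ _; set c := M _ _; set d := M _ _ => ab cd.
apply: le_trans (ler_normB _ _) _; rewrite !normrM expr2.
apply: (@le_trans _ _ ((`|a| + `|b|) * (`|c| + `|d|))); last first.
  by rewrite ler_pM ?addr_ge0.
rewrite mulrDl !mulrDr [X in _ <= X + _]addrC [leRHS]addrACA lerDl.
by rewrite addr_ge0 ?mulr_ge0.
Qed.

End InfNorm.

(** * Convergence to the joint spectral radius *)

Section JointSpectralRadius.
Variable R : realType.

Definition words n (H : set 'M[R]_n) (k : nat) : set (seq 'M[R]_n) :=
  [set s | size s = k /\ {in s, forall M, H M}].

(** Products over sequences, unlike products over ordinals, can be cut into
    factors by taking prefixes and suffixes. *)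
Lemma jsr_seq_prodE n (H : set 'M[R]_n) k :
  [set (mx_infnorm (\prod_(i < k) F (rev_ord i))) `^ (k%:R^-1)
      | F in [set F : 'I_k -> 'M[R]_n | forall i, H (F i)]] =
  [set (mx_infnorm (\prod_(M <- s) M)) `^ (k%:R^-1)
      | s in words H k].
Proof.
apply/seteqP; split => x /= [].
- move=> F HF <-; exists [seq F (rev_ord i) | i <- enum 'I_k].
    by split=> [|_ /mapP[i _ ->]//]; rewrite size_map size_enum_ord.
  by rewrite big_map enumT.
- move=> s [sk Hs] <-; exists (fun i => nth 1 s (rev_ord i)).
    by move=> i /=; apply/Hs/mem_nth; rewrite sk; case: i => i /= ?; lia.
  under eq_bigr do rewrite rev_ordK.
  by rewrite [in RHS](big_nth 1) sk big_mkord.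
Qed.

Section Fekete.
Variables (n : nat) (H : set 'M[R]_n) (B : R).
Hypotheses (B0 : 0 <= B) (HB : forall M, H M -> mx_infnorm M <= B).
Hypothesis Hne : H !=set0.

Let words_ne k : words H k !=set0.
Proof.
have [M HM] := Hne; exists (nseq k M); split; first by rewrite size_nseq.
by move=> N; rewrite mem_nseq => /andP[_ /eqP ->].
Qed.

Lemma jsr_seq_le k c : 0 <= c ->
  (forall s, size s = k.+1 -> {in s, forall M, H M} ->
     mx_infnorm (\prod_(M <- s) M) <= c ^+ k.+1) ->
  jsr_seq H k.+1 <= c.
Proof.
move=> c0 Hc; rewrite /jsr_seq jsr_seq_prodE; apply: ge_sup.
  by have [s ws] := words_ne k.+1; eexists; exists s.
move=> _ [s [sk Hs] <-]; rewrite -[leRHS]powRr1 //.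
rewrite -[X in c `^ X](@divff _ k.+1%:R) ?pnatr_eq0 // powRrM.
rewrite powR_mulrn //; apply: ge0_ler_powR; last exact: Hc.
- by rewrite invr_ge0.
- by rewrite nnegrE mx_infnorm_ge0.
- by rewrite nnegrE exprn_ge0.
Qed.

Lemma has_ubound_jsr k : has_ubound
  [set (mx_infnorm (\prod_(M <- s) M)) `^ (k%:R^-1) | s in words H k].
Proof.
exists ((B ^+ k) `^ k%:R^-1) => _ [s [sk Hs] <-].
apply: ge0_ler_powR; rewrite ?nnegrE ?invr_ge0 ?mx_infnorm_ge0 ?exprn_ge0 // -sk.
by apply: mx_infnorm_prod_le => // M /Hs/HB.
Qed.

Lemma mx_infnorm_prod_jsr k s : size s = k.+1 -> {in s, forall M, H M} ->
  mx_infnorm (\prod_(M <- s) M) <= jsr_seq H k.+1 ^+ k.+1.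
Proof.
move=> sk Hs; have N0 := mx_infnorm_ge0 (\prod_(M <- s) M).
have le_jsr : mx_infnorm (\prod_(M <- s) M) `^ k.+1%:R^-1 <= jsr_seq H k.+1.
  rewrite /jsr_seq jsr_seq_prodE; apply: ub_le_sup; last by exists s.
  exact: has_ubound_jsr.
rewrite -[leLHS]powRr1 // -[X in _ `^ X](@mulVf _ k.+1%:R) ?pnatr_eq0 //.
by rewrite powRrM powR_mulrn ?powR_ge0 // lerXn2r ?nnegrE ?powR_ge0 //
  (le_trans _ le_jsr) ?powR_ge0.
Qed.

Lemma jsr_seq_ge0 k : 0 <= jsr_seq H k.
Proof.
rewrite /jsr_seq jsr_seq_prodE; have [s ws] := words_ne k.
apply: le_trans (ub_le_sup (has_ubound_jsr k) _); last by exists s.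
exact: powR_ge0.
Qed.

(** Cutting off q blocks of length m + 1: each block is bounded by means of
    the term m + 1 of the sequence, each leftover factor by B. *)
Lemma mx_infnorm_prod_div m q s : {in s, forall M, H M} ->
  (q * m.+1 <= size s)%N ->
  mx_infnorm (\prod_(M <- s) M) <=
    jsr_seq H m.+1 ^+ (q * m.+1) * B ^+ (size s - q * m.+1).
Proof.
elim: q s => [|q IHq] s Hs sq.
  by rewrite mul0n subn0 expr0 mul1r mx_infnorm_prod_le // => M /Hs/HB.
have ms : (m.+1 <= size s)%N by rewrite (leq_trans _ sq) // mulSn leq_addr.
have Ht : {in take m.+1 s, forall M, H M} by move=> M /mem_take/Hs.
have Hd : {in drop m.+1 s, forall M, H M} by move=> M /mem_drop/Hs.
have sd : (q * m.+1 <= size (drop m.+1 s))%N by rewrite size_drop; lia.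
rewrite -{1}(cat_take_drop m.+1 s) big_cat /= mulSn exprD -mulrA subnDA.
rewrite -size_drop; apply: le_trans (mx_infnormM _ _) _.
rewrite ler_pM ?mx_infnorm_ge0 ?IHq //.
by rewrite mx_infnorm_prod_jsr // size_takel.
Qed.

(** The core of Fekete's argument.  Fix d strictly between the term m + 1 and
    c.  A product of k factors is at most K d^k, where K accounts for the at
    most m factors left over by the division of k by m + 1.  As d < c, this is
    below c^k for large k. *)
Lemma jsr_seq_near_le m c :
  jsr_seq H m.+1 < c -> \forall k \near \oo, jsr_seq H k <= c.
Proof.
move=> mc; have u0 := jsr_seq_ge0 m.+1.
have [d [d0 ud dc]] : exists d, [/\ 0 < d, jsr_seq H m.+1 <= d & d < c].
  by exists ((jsr_seq H m.+1 + c) / 2); split; lra.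
have c0 : 0 < c := lt_trans d0 dc.
set K := Num.max 1 (B / d) ^+ m.+1.
have K1 : 1 <= Num.max 1 (B / d) by rewrite le_max lexx.
have dcK : K * (d / c) ^+ k @[k --> \oo] --> 0.
  apply: cvg_geometric; rewrite ger0_norm; last by rewrite divr_ge0 ?ltW.
  by rewrite ltr_pdivrMr ?mul1r.
have : \forall k \near \oo, K * (d / c) ^+ k < 1.
  exact: (cvgr_lt _ dcK).
move=> nearK; near=> k.
have kK : K * (d / c) ^+ k < 1 by near: k.
have k0 : (0 < k)%N by near: k; exact: nbhs_infty_gt.
rewrite -(prednK k0); apply: jsr_seq_le => [|s sk Hs]; first exact: ltW.
rewrite prednK // in sk *.
have := @mx_infnorm_prod_div m (k %/ m.+1) s Hs.
rewrite sk leq_trunc_div => /(_ isT).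
move/le_trans; apply.
have -> : (k - k %/ m.+1 * m.+1 = k %% m.+1)%N.
  by rewrite {1}(divn_eq k m.+1) addKn.
have kE := divn_eq k m.+1.
apply: (@le_trans _ _ (d ^+ k * K)); last first.
  move: kK; rewrite expr_div_n mulrA ltr_pdivrMr ?exprn_gt0 // mul1r mulrC.
  exact: ltW.
have -> : d ^+ k = d ^+ (k %/ m.+1 * m.+1) * d ^+ (k %% m.+1).
  by rewrite -exprD -kE.
rewrite -mulrA; apply: ler_pM; rewrite ?exprn_ge0 //.
  by rewrite lerXn2r ?nnegrE ?(ltW d0).
rewrite -ler_pdivrMl ?exprn_gt0 // mulrC -expr_div_n.
apply: (@le_trans _ _ (Num.max 1 (B / d) ^+ (k %% m.+1))).
  apply: lerXn2r; last by rewrite le_max lexx orbT.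
    by rewrite nnegrE divr_ge0 ?(ltW d0).
  by rewrite nnegrE (le_trans ler01 K1).
by rewrite /K ler_weXn2l // ltnW // ltn_mod.
Unshelve. all: by end_near. Qed.

(** The term 0 is excluded from the infimum: it is a power with exponent
    1/0 = 0, hence equal to 1 whatever the family. *)
Lemma cvg_jsr_seq : jsr_seq H @ \oo --> inf [set jsr_seq H k.+1 | k in setT].
Proof.
set L := inf _.
have lbL k : L <= jsr_seq H k.+1.
  by apply: ge_inf; [exists 0 => _ [j _ <-]; exact: jsr_seq_ge0 | exists k].
apply/cvgrPdist_le => e e0.
have [_ [m _ <-] mL] : exists2 x, [set jsr_seq H k.+1 | k in setT] x & x < L + e.
  apply: inf_adherent => //; split; first by exists (jsr_seq H 1), 0%N.
  by exists 0 => _ [j _ <-]; exact: jsr_seq_ge0.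
have nle := jsr_seq_near_le mL.
near=> k.
have k0 : (0 < k)%N by near: k; exact: nbhs_infty_gt.
have kL : jsr_seq H k <= L + e by near: k.
have := lbL k.-1; rewrite prednK // => Lk.
by rewrite distrC ger0_norm ?subr_ge0 // lerBlDl.
Unshelve. all: by end_near. Qed.

(** The powers of a member of H are among the products, so each term of
    positive index, and with it the infimum of these terms, is at least c. *)
Lemma joint_spectral_radius_ge M c :
    H M -> 0 <= c -> (forall k, c ^+ k <= mx_infnorm (M ^+ k)) ->
  c <= joint_spectral_radius H.
Proof.
move=> HM c0 Mc; rewrite /joint_spectral_radius (cvg_lim _ cvg_jsr_seq) //.
apply: lb_le_inf; first by exists (jsr_seq H 1), 0%N.
move=> _ [k _ <-].
have Hs : {in nseq k.+1 M, forall N, H N}.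
  by move=> N; rewrite mem_nseq => /andP[_ /eqP ->].
have := mx_infnorm_prod_jsr (size_nseq _ _) Hs.
rewrite big_nseq iter_mulr_1 => /(le_trans (Mc _)).
by rewrite ler_pXn2r ?nnegrE ?jsr_seq_ge0.
Qed.

Lemma joint_spectral_radius_le : joint_spectral_radius H <= B.
Proof.
rewrite /joint_spectral_radius (cvg_lim _ cvg_jsr_seq) //.
apply: (@le_trans _ _ (jsr_seq H 1)).
  by apply: ge_inf; [exists 0 => _ [j _ <-]; exact: jsr_seq_ge0 | exists 0%N].
by apply: jsr_seq_le => // s <- Hs; apply: mx_infnorm_prod_le => // M /Hs/HB.
Qed.

End Fekete.
End JointSpectralRadius.

(** * The two-dimensional momentum matrix *)

Section MomentumMatrix.
Variable R : realType.
Implicit Types (t p : R) (z w : R[i]).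

Lemma det_C_minus gamma alpha eta : \det (C_minus gamma alpha eta) = eta :> R.
Proof.
rewrite det_mx1D1 block_mxKul block_mxKdr block_mxKur block_mxKdl !mxE eqxx.
by rewrite !mulr1n mulr0 sub0r mulr1 opprK.
Qed.

(** The product of the two eigenvalues is eta.  The determinant expresses this
    without any reference to the eigenvalues, complex or not. *)
Lemma sqrt_le_C_minus_exp gamma alpha (eta : R) k : 0 <= eta ->
  Num.sqrt eta ^+ k <= mx_infnorm (C_minus gamma alpha eta ^+ k).
Proof.
move=> eta0.
rewrite -(@ler_pXn2r _ 2) ?nnegrE ?exprn_ge0 ?sqrtr_ge0 ?mx_infnorm_ge0 //.
rewrite exprAC sqr_sqrtr //; apply: le_trans (normr_det_le _).
elim: k => [|k IHk]; first by rewrite !expr0 det1 normr1.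
rewrite !exprS -[X in \det X]/(C_minus gamma alpha eta *m _) det_mulmx normrM.
by rewrite det_C_minus ger0_norm // ler_wpM2l.
Qed.

(** The column (r, 1) is an eigenvector for r; it has sup norm 1 as r <= 1, so
    it intertwines the matrix with the scalar r. *)
Lemma C_minus0_exp (gamma alpha : R) k (r := 1 - alpha * (1 - gamma)) :
  0 <= r <= 1 ->
  r ^+ k <= mx_infnorm (C_minus gamma alpha 0 ^+ k).
Proof.
move=> /andP[r0 r1]; apply: le_trans (mx_infnorm_scalar1 r k) _.
pose J : 'cV[R]_(1 + 1) := col_mx r%:M 1%:M.
have CJ : C_minus gamma alpha 0 *m J = J *m r%:M.
  rewrite /C_minus addr0 /J mul_block_col mul_col_mx.
  by rewrite !mul0mx !mul1mx oppr0 raddf0 mul0mx !addr0.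
apply: (mx_infnorm_intertwine (intertwine_exp k CJ)) => [j|l].
  rewrite big_ord1 /J -[j]splitK; case: (split j) => j' /=.
    by rewrite col_mxEu mxE !ord1 mulr1n ger0_norm.
  by rewrite col_mxEd mxE !ord1 normr1.
exists (rshift 1 ord0); rewrite rowKd; apply/rowP => j.
by rewrite !mxE !ord1.
Qed.

Lemma sup_set2 (x y : R) : sup [set x; y] = Num.max x y.
Proof.
have ub : ubound [set x; y] (Num.max x y).
  by move=> _ []->; rewrite le_max lexx ?orbT.
have hub : has_ubound [set x; y] by exists (Num.max x y).
apply/eqP; rewrite eq_le ge_max ge_sup //=; last by exists x; left.
by apply/andP; split; apply: ub_le_sup => //; [left|right].
Qed.

(** For a row eigenvector (a, b), the first coordinate of the eigenvalue
    equation gives b = (z - t) a with t the upper left entry; the second one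
    then says that z is a root of the characteristic polynomial. *)
Lemma eigenvalue_C_minus (gamma alpha eta : R) z :
  eigenvalue (map_mx (real_complex R) (C_minus gamma alpha eta)) z =
  (z ^+ 2 - (1 - alpha * (1 - gamma) + eta)%:C%C * z + eta%:C%C == 0).
Proof.
set t := 1 - _ + eta.
have mulC (a b : 'rV[R[i]]_1) :
    row_mx a b *m map_mx (real_complex R) (C_minus gamma alpha eta) =
    row_mx (t%:C%C *: a + b) (- eta%:C%C *: a).
  rewrite /C_minus map_block_mx mul_row_block -/t !map_scalar_mx !map_mx0 /=.
  by rewrite !mul_mx_scalar scale1r mulmx0 addr0 raddfN.
apply/eigenvalueP/eqP => [[v]|z_root].
- rewrite -[v]hsubmxK mulC scale_row_mx; set a := lsubmx v; set b := rsubmx v.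
  case/eq_row_mx => [ab ba] v0.
  have bE : b = (z - t%:C%C) *: a by rewrite scalerBl -ab addrAC subrr add0r.
  have a0 : a != 0.
    by apply: contraNneq v0 => a0; rewrite bE a0 scaler0 row_mx0.
  apply/eqP; move: ba; rewrite bE scalerA => /eqP; rewrite -subr_eq0 -scalerBl.
  rewrite scaler_eq0 (negbTE a0) orbF -oppr_eq0 => /eqP e.
  by apply/eqP; rewrite -[RHS]e; ring.
- exists (row_mx 1%:M ((z - t%:C%C)%:M)).
    rewrite mulC scale_row_mx; congr row_mx.
      by apply/matrixP => i j; rewrite !mxE !ord1 !mulr1n; ring.
    apply/matrixP => i j; rewrite !mxE !ord1 !mulr1n.
    by rewrite -[RHS]subr0 -z_root; ring.
  rewrite -row_mx0; apply/eqP => /eq_row_mx[/matrixP/(_ 0 0)/eqP + _].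
  by rewrite !mxE oner_eq0.
Qed.

Lemma quadratic_factor (t p : R) : exists z w, [/\ z + w = t%:C%C, z * w = p%:C%C &
  forall x : R[i], (x ^+ 2 - t%:C%C * x + p%:C%C == 0) = (x == z) || (x == w)].
Proof.
have [u uE] : exists u : R[i], u ^+ 2 = (t ^+ 2 - 4 * p)%:C%C.
  by exists (sqrtc (t ^+ 2 - 4 * p)%:C%C); rewrite sqr_sqrtc.
have zDw : (t%:C%C + u) / 2 + (t%:C%C - u) / 2 = t%:C%C by field.
have zMw : (t%:C%C + u) / 2 * ((t%:C%C - u) / 2) = p%:C%C.
  transitivity ((t%:C%C ^+ 2 - u ^+ 2) / 4); first by field.
  by rewrite uE rmorphB rmorphXn rmorphM /= -[4%:C%C]/(4%:R%:C%C) rmorph_nat; field.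
move: zDw zMw; set z := (_ + u) / 2; set w := (_ - u) / 2 => zDw zMw.
exists z, w; split=> // x.
rewrite -(subr_eq0 x z) -(subr_eq0 x w) -mulf_eq0.
by rewrite -zMw -zDw; congr (_ == 0); ring.
Qed.

Lemma normc_ge0 z : 0 <= normc z.
Proof. by case: z => a b; exact: sqrtr_ge0. Qed.

Lemma normc_real (a : R) : normc (a%:C%C) = `|a|.
Proof. by rewrite /= expr0n addr0 sqrtr_sqr. Qed.

(** Write z = a + x i and w = b + y i.  The sum is real, so y = - x; the
    product is real, so x (b - a) = 0.  Hence both numbers are real or they are
    conjugate, and then the common squared modulus is their product. *)
Lemma conj_or_real (t p : R) z w : z + w = t%:C%C -> z * w = p%:C%C ->
  normc z ^+ 2 = p /\ normc w ^+ 2 = p \/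
  exists a b : R, [/\ z = a%:C%C, w = b%:C%C, a + b = t & a * b = p].
Proof.
case: z => a x; case: w => b y /eqP.
rewrite eq_complex /= => /andP[/eqP abt /eqP xy] /eqP; rewrite eq_complex /= => /andP[/eqP re /eqP im].
have yE : y = - x by lra.
have [x0|x0] := eqVneq x 0.
  by right; exists a, b; split=> //; rewrite -?re ?yE ?x0 ?oppr0 ?mulr0 ?subr0.
left; rewrite !sqr_sqrtr ?addr_ge0 ?sqr_ge0 //.
have ba : b = a.
  apply/eqP; rewrite -subr_eq0; move: im; rewrite yE => /eqP.
  by rewrite (_ : _ + _ = x * (b - a)) ?mulf_eq0 ?(negbTE x0) //; ring.
by rewrite -re ba yE; split; ring.
Qed.

Lemma mulr_gt0_addr_ge0_gt0 (a b : R) : 0 < a * b -> 0 <= a + b -> 0 < a.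
Proof.
move=> ab0 abD; rewrite ltNge; apply/negP => a0.
have b0 : 0 <= b by lra.
by move: ab0; rewrite ltNge mulr_le0_ge0.
Qed.

(** Numbers a and b on the same side of r are on its left when a b < r^2. *)
Lemma ltr_mulr_lt_sqr (a b r : R) :
  0 <= r -> 0 < (a - r) * (b - r) -> a * b < r ^+ 2 -> a < r.
Proof.
move=> r0 abr abr2; rewrite ltNge; apply/negP => ra.
have br : r < b.
  rewrite ltNge; apply/negP => br.
  by move: abr; rewrite ltNge mulr_ge0_le0 ?subr_ge0 ?subr_le0.
by move: abr2; rewrite expr2 ltNge ler_pM // ltW.
Qed.

Lemma spectral_radius_C_minus_lt (gamma alpha eta : R)
    (r := 1 - alpha * (1 - gamma)) :
  0 <= r -> r < 1 -> 0 <= eta ->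
  spectral_radius (C_minus gamma alpha eta) < r <-> 0 < eta < r ^+ 2.
Proof.
move=> r0 r1 eta0.
have [z [w [zDw zMw rootE]]] := quadratic_factor (r + eta) eta.
have rhoE : spectral_radius (C_minus gamma alpha eta) = Num.max (normc z) (normc w).
  rewrite /spectral_radius -sup_set2; congr sup.
  apply/seteqP; split=> [_ [x + <-]|_ []->] /=.
  - by rewrite /mkset eigenvalue_C_minus rootE => /orP[]/eqP ->; [left|right].
  - by exists z => //; rewrite /mkset eigenvalue_C_minus rootE eqxx.
  - by exists w => //; rewrite /mkset eigenvalue_C_minus rootE eqxx orbT.
rewrite rhoE gt_max; clearbody r; split=> [/andP[zr wr]|/andP[e0 er]].
  apply/andP; split.
    rewrite lt_def eta0 andbT; apply/eqP => e0.
    (* r is a root when eta = 0 *)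
    have /esym := rootE r%:C%C; rewrite e0 (addr0 r) rmorph0 addr0 expr2 subrr eqxx.
    have rr : ~ normc r%:C%C < r by rewrite normc_real ger0_norm // ltxx.
    by case/orP => /eqP rE; apply: rr; rewrite rE.
  rewrite -(ger0_norm eta0) -normc_real -zMw ComplexField.Normc.normcM expr2.
  by rewrite ltr_pM ?normc_ge0.
have [[zn wn]|[a [b [-> -> abD abM]]]] := conj_or_real zDw zMw.
  have lt_r x : normc x ^+ 2 = eta -> normc x < r.
    by move=> xE; rewrite -(@ltr_pXn2r _ 2) ?nnegrE ?normc_ge0 // xE.
  by rewrite !lt_r.
rewrite !normc_real.
(* this is the value at r of the characteristic polynomial *)
have abr : 0 < (a - r) * (b - r).
  have -> : (a - r) * (b - r) = a * b - r * (a + b) + r ^+ 2 by ring.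
  by rewrite abD abM (_ : _ + _ = eta * (1 - r)) ?mulr_gt0 ?subr_gt0 //; ring.
have abD0 : 0 <= a + b by rewrite abD addr_ge0.
have ab0 : 0 < a * b by rewrite abM.
have er_ab : a * b < r ^+ 2 by rewrite abM.
rewrite !gtr0_norm; last 2 first.
- by apply: (@mulr_gt0_addr_ge0_gt0 b a); rewrite 1?mulrC 1?addrC.
- exact: mulr_gt0_addr_ge0_gt0 abD0.
apply/andP; split; first exact: ltr_mulr_lt_sqr abr er_ab.
by apply: (@ltr_mulr_lt_sqr b a); rewrite // mulrC.
Qed.

End MomentumMatrix.

(** * Q-value iteration and heavy-ball matrices *)

Section MDP.
Variables (R : realType) (S A : finType) (P : S -> A -> S -> R).
Hypothesis P_transition : is_transition P.
Variables (gamma alpha : R).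
Let r := 1 - alpha * (1 - gamma).
Let n := #|{: S * A}|.

Lemma policy_mx_const1 (pi : {ffun S -> A}) :
  policy_mx R pi *m const_mx 1 = const_mx 1 :> 'cV_#|S|.
Proof.
apply/matrixP => i j; rewrite !mxE.
pose x := (enum_val i, pi (enum_val i)).
rewrite (bigD1 (enum_rank x)) //= !mxE enum_rankK eqxx mulr1 big1 ?addr0 // => k kx.
rewrite !mxE mulr1; case: eqP => // kE; case/eqP: kx.
by rewrite -[x]kE enum_valK.
Qed.

Lemma trans_mx_const1 : trans_mx P *m const_mx 1 = const_mx 1 :> 'cV_n.
Proof.
apply/matrixP => i j; rewrite !mxE.
have [_ P1] := P_transition (enum_val i).1 (enum_val i).2; rewrite -[RHS]P1.
rewrite (reindex (@enum_val S S)) /=; last exact/onW_bij/enum_val_bij.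
by apply: eq_bigr => k _; rewrite !mxE mulr1.
Qed.

Lemma trans_policy_const1 (pi : {ffun S -> A}) :
  trans_mx P *m policy_mx R pi *m const_mx 1 = const_mx 1 :> 'cV_n.
Proof. by rewrite -mulmxA policy_mx_const1 trans_mx_const1. Qed.

Lemma A_QVI_const1 pi :
  A_QVI P gamma alpha pi *m const_mx 1 = const_mx 1 *m r%:M :> 'cV_n.
Proof.
rewrite mulmxDl mul_scalar_mx -scalemxAl trans_policy_const1 mul_mx_scalar.
by rewrite -scalerDl; congr (_ *: _); rewrite /r; ring.
Qed.

(** The columns of J are the indicators of the two blocks of coordinates. *)
Lemma A_HB_C_minus eta pi
    (J := block_mx (const_mx 1 : 'cV_n) 0 0 (const_mx 1 : 'cV_n)) :
  A_HB P gamma alpha eta pi *m J = J *m C_minus gamma alpha eta.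
Proof.
rewrite /J /A_HB /C_minus !mulmx_block !mulmx0 !mul0mx !addr0 !add0r.
rewrite mul1mx mulmx1 mul_scalar_mx mul_mx_scalar mulmxDl mul_scalar_mx -scalemxAl.
rewrite trans_policy_const1 mul_mx_scalar -scalerDl.
by congr (block_mx (_ *: _) _ _ _); ring.
Qed.

Lemma A_QVI_ge0 pi i j : 0 <= gamma -> 0 <= alpha <= 1 ->
  0 <= A_QVI P gamma alpha pi i j.
Proof.
move=> g0 /andP[a0 a1]; rewrite !mxE addr_ge0 ?mulrn_wge0 ?subr_ge0 //.
rewrite mulr_ge0 ?mulr_ge0 // sumr_ge0 // => k _; rewrite !mxE mulr_ge0 ?ler0n //.
by have [] := P_transition (enum_val i).1 (enum_val i).2.
Qed.

Hypotheses (gamma_ge0 : 0 <= gamma) (gamma_le1 : gamma <= 1).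
Hypotheses (alpha_ge0 : 0 <= alpha) (alpha_le1 : alpha <= 1).
Hypotheses (S_neq0 : (0 < #|S|)%N) (A_neq0 : (0 < #|A|)%N).

Let r_ge0 : 0 <= r.
Proof. by rewrite subr_ge0 mulr_ile1 ?subr_ge0 ?gerBl. Qed.

Let policy_exists : exists pi : {ffun S -> A}, True.
Proof. by have [a _] := card_gt0P A_neq0; exists [ffun => a]. Qed.

Let n_gt0 : (0 < n)%N.
Proof. by rewrite /n card_prod muln_gt0 S_neq0. Qed.

(** The upper bound is a bound on single factors; the lower bound comes from
    the powers of one matrix, with the all-ones column as eigenvector. *)
Lemma joint_spectral_radius_QVI :
  joint_spectral_radius (QVI_family P gamma alpha) = r.
Proof.
have norm_le M : QVI_family P gamma alpha M -> mx_infnorm M <= r.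
  case=> pi _ <-; apply: mx_infnorm_const_rows => // [i j|].
    by rewrite A_QVI_ge0 ?alpha_ge0.
  rewrite A_QVI_const1 mul_mx_scalar.
  by apply/matrixP => i j; rewrite !mxE mulr1.
have [pi _] := policy_exists.
have fpi : QVI_family P gamma alpha (A_QVI P gamma alpha pi) by exists pi.
have fne : QVI_family P gamma alpha !=set0 by eexists; exact: fpi.
apply/eqP; rewrite eq_le; apply/andP; split.
  exact: joint_spectral_radius_le r_ge0 norm_le fne.
apply: (joint_spectral_radius_ge r_ge0 norm_le fne fpi r_ge0) => k.
apply: le_trans (mx_infnorm_scalar1 r k) _.
apply: (mx_infnorm_intertwine (intertwine_exp k (A_QVI_const1 pi))) => [j|l].
  by rewrite big_ord1 mxE normr1.
by exists (Ordinal n_gt0); apply/rowP => j; rewrite !mxE !ord1.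
Qed.

(** The heavy-ball matrix of every policy contains C_eta^- as a block action,
    so one policy suffices to transfer growth of the powers of C_eta^-. *)
Lemma joint_spectral_radius_HB_ge eta c : 0 <= c ->
  (forall k, c ^+ k <= mx_infnorm (C_minus gamma alpha eta ^+ k)) ->
  c <= joint_spectral_radius (HB_family P gamma alpha eta).
Proof.
move=> c0 Cc; have [pi _] := policy_exists.
pose B :=
  \big[Num.max/0]_(pi : {ffun S -> A}) mx_infnorm (A_HB P gamma alpha eta pi).
have fpi : HB_family P gamma alpha eta (A_HB P gamma alpha eta pi) by exists pi.
have fB M : HB_family P gamma alpha eta M -> mx_infnorm M <= B.
  case=> pi' _ <-.
  exact: (le_bigmax 0 (fun pi => mx_infnorm (A_HB P gamma alpha eta pi))).
have B0 : 0 <= B by exact: bigmax_ge_id.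
have fne : HB_family P gamma alpha eta !=set0 by eexists; exact: fpi.
apply: (joint_spectral_radius_ge B0 fB fne fpi c0) => k; apply: le_trans (Cc k) _.
apply: (mx_infnorm_intertwine (intertwine_exp k (A_HB_C_minus eta pi))) => [j|l].
  rewrite -[j]splitK big_split_ord !big_ord1; case: (split j) => j' /=.
    by rewrite block_mxEul block_mxEur !mxE normr1 normr0 addr0.
  by rewrite block_mxEdl block_mxEdr !mxE normr1 normr0 add0r.
(* any row of the block numbered l *)
pose i0 := Ordinal n_gt0.
exists (unsplit (if split l is inl _ then inl i0 else inr i0)).
rewrite -[l in RHS]splitK; apply/rowP => j; rewrite -[j]splitK mxE [RHS]mxE eqxx /=.
rewrite (inj_eq (can_inj (@unsplitK _ _))).
case: (split l) (split j) => l' [] j' /=; rewrite !ord1 ?eqxx.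
- by rewrite block_mxEul mxE.
- by rewrite block_mxEur mxE.
- by rewrite block_mxEdl mxE.
- by rewrite block_mxEdr mxE.
Qed.

End MDP.

Theorem proposition5p1 (R : realType) (S A : finType)
    (S_neq0 : (0 < #|S|)%N) (A_neq0 : (0 < #|A|)%N)
    (P : S -> A -> S -> R) (P_transition : is_transition P)
    (gamma : R) (gamma_gt0 : 0 < gamma) (gamma_lt1 : gamma < 1)
    (alpha : R) (alpha_gt0 : 0 < alpha) (alpha_le1 : alpha <= 1)
    (eta : R) (eta_ge0 : 0 <= eta) :
  let rho_QVI := joint_spectral_radius (QVI_family P gamma alpha) in
  let rho_HB := joint_spectral_radius (HB_family P gamma alpha eta) in
  [/\ rho_QVI = 1 - alpha * (1 - gamma),
      spectral_radius (C_minus gamma alpha eta) < rho_QVI <->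
        0 < eta < rho_QVI ^+ 2
    & rho_HB < rho_QVI -> 0 < eta < rho_QVI ^+ 2].
Proof.
set r := 1 - alpha * (1 - gamma) => rho_QVI rho_HB.
have [g0 g1 a0] : [/\ 0 <= gamma, gamma <= 1 & 0 <= alpha] by rewrite !ltW.
have QVIE : rho_QVI = r by exact: joint_spectral_radius_QVI.
have r0 : 0 <= r by rewrite subr_ge0 mulr_ile1 ?subr_ge0 ?gerBl.
have r1 : r < 1 by rewrite gtrBl mulr_gt0 ?subr_gt0.
rewrite QVIE; split=> [//||HB_lt]; first exact: spectral_radius_C_minus_lt.
have HB_ge c : 0 <= c ->
    (forall k, c ^+ k <= mx_infnorm (C_minus gamma alpha eta ^+ k)) -> c <= rho_HB.
  exact: joint_spectral_radius_HB_ge.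
apply/andP; split.
  rewrite lt_def eta_ge0 andbT; apply/eqP => eta0.
  move: HB_lt; rewrite ltNge => /negP; apply; apply: HB_ge => // k.
  by rewrite eta0 C_minus0_exp // r0 ltW.
rewrite -(sqr_sqrtr eta_ge0) ltr_pXn2r ?nnegrE ?sqrtr_ge0 //.
apply: le_lt_trans HB_lt; apply: HB_ge => [|k]; first exact: sqrtr_ge0.
exact: sqrt_le_C_minus_exp.
Qed.
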